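(* Let $B>1$ and $N>1$ be integers with $\gcd(N,B)=1$, let $e=\operatorname{ord}(B,N)$, and let $d_1,d_2$ be positive integers with $d_1\mid d_2$ and $d_2\mid e$. If $N\in M_{d_1}(B)$, then $N\in M_{d_2}(B)$.
   Context: $\operatorname{ord}(B,N)$ is the least positive integer $e$ with $B^e\equiv1\pmod N$. For a divisor $d$ of $e$ put $k=e/d$. For $x$ with $1\le x<N$, $\gcd(x,N)=1$, let $x/N=0.a_1a_2\ldots$ be its base-$B$ expansion (purely periodic with period $a_1\ldots a_e$), and let $S_d(x)=\sum_{j=1}^d\sum_{i=1}^k a_{(j-1)k+i}B^{k-i}$ be the sum of the integers represented in base $B$ by the $d$ consecutive blocks of length $k$ of the period. We say $N\in M_d(B)$ if $S_d(x)\equiv0\pmod{B^k-1}$ for every such $x$. *)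

(* Defs.v *)
From mathcomp Require Import all_boot all_order all_algebra cyclic.

Set Implicit Arguments.
Unset Strict Implicit.
Unset Printing Implicit Defensive.

Import Order.TTheory GRing.Theory Num.Theory.

(* The guard [coprime B N] only makes the minimum exist for all [B] and [N]. *)
Lemma ord_ex (B N : nat) :
  exists e, (0 < e) && (coprime B N ==> (B ^ e == 1 %[mod N])).
Proof.
have [cop|ncop] := boolP (coprime B N); last by exists 1.
case: N cop => [|N] cop.
  by exists 1; move: cop; rewrite /coprime gcdn0 => /eqP ->.
exists (totient N.+1); rewrite totient_gt0 /=.
by apply/eqP; exact: Euler_exp_totient.
Qed.

Definition ord (B N : nat) : nat := ex_minn (ord_ex B N).

Lemma ordP (B N : nat) : coprime B N ->
  [/\ 0 < ord B N, B ^ ord B N = 1 %[mod N]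
    & forall m, 0 < m -> B ^ m = 1 %[mod N] -> ord B N <= m].
Proof.
move=> cop; rewrite /ord; case: ex_minnP => e; rewrite cop /=.
move=> /andP[e0 /eqP Be] emin; split=> // m m0 Bm.
by apply: emin; rewrite m0; apply/eqP.
Qed.

(* The i-th digit (i >= 1) after the radix point of x / N in base B, namely
   floor (B ^ i * (x / N)) mod B; see [digit_lt] and [digit_expansion]. *)
Definition digit (B N x i : nat) : nat := (B ^ i * x %/ N) %% B.

Lemma digit_lt (B N x i : nat) : 1 < B -> digit B N x i < B.
Proof. by move=> B1; rewrite ltn_mod; exact: ltnW. Qed.

Lemma digit_trunc (B N x n : nat) : 1 < B -> x < N ->
  B ^ n * x %/ N = \sum_(1 <= i < n.+1) digit B N x i * B ^ (n - i).
Proof.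
move=> B1 xN; have N0 : 0 < N by exact: leq_ltn_trans xN.
elim: n => [|n IHn]; first by rewrite big_geq // expn0 mul1n divn_small.
rewrite big_nat_recr //= subnn expn0 muln1 {1}(divn_eq (_ %/ N) B).
congr (_ + _); rewrite -divnMA expnS -mulnA [N * B]mulnC.
rewrite divnMl 1?ltnW // IHn mulnC big_distrr /=.
by apply: eq_big_nat => i /andP[_ ilen]; rewrite subSn // expnS mulnCA.
Qed.

Lemma digit_expansion (B N x n : nat) (s : rat) : 1 < B -> x < N ->
  s = (\sum_(1 <= i < n.+1) (digit B N x i)%:R / B%:R ^+ i)%R ->
  (s <= x%:R / N%:R < s + 1 / B%:R ^+ n)%R.
Proof.
move=> B1 xN sE; have N0 : 0 < N by exact: leq_ltn_trans xN.
have B0 : (0 < B%:R :> rat)%R by rewrite ltr0n ltnW.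
have Bn0 : (0 < B%:R ^+ n :> rat)%R by rewrite exprn_gt0.
have -> : s = ((B ^ n * x %/ N)%:R / B%:R ^+ n)%R.
  rewrite sE digit_trunc // natr_sum mulr_suml; apply: eq_big_nat => i.
  move=> /andP[_ ilen]; rewrite natrM natrX -mulrA; congr (_ * _)%R.
  have -> : (B%:R ^+ n = B%:R ^+ (n - i) * B%:R ^+ i :> rat)%R.
    by rewrite -exprD subnK.
  by rewrite invfM mulrA divff ?mul1r // expf_neq0 ?gt_eqF.
rewrite -mulrDl ler_pdivrMr // ltr_pdivlMr // mulrAC.
rewrite ler_pdivlMr ?ltr0n // ltr_pdivrMr ?ltr0n // -natrX -!natrM natr1.
rewrite -natrM ler_nat ltr_nat mulnC [x * _]mulnC.
by rewrite mulnC leq_divM ltn_ceil.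
Qed.

Lemma digit_periodic (B N x i : nat) : 1 < N -> coprime B N -> 0 < i ->
  digit B N x (i + ord B N) = digit B N x i.
Proof.
move=> N1 cop i0; have [_ Be _] := ordP cop.
rewrite /digit expnD (divn_eq (B ^ ord B N) N) Be (modn_small N1).
rewrite mulnDr muln1 mulnDl addnC !mulnA [_ * N * x]mulnAC.
rewrite divnDMl 1?ltnW //; case: i i0 => // i _.
by rewrite expnS -!mulnA [B * (B ^ i * (_ * x))]mulnC addnC modnMDl.
Qed.

Definition block_sum (B N d x : nat) : nat :=
  let k := ord B N %/ d in
  \sum_(1 <= j < d.+1) \sum_(1 <= i < k.+1)
    digit B N x ((j - 1) * k + i) * B ^ (k - i).

(* Intended for [B > 1], [N > 1] prime to [B], and [d] a positive divisor of
   [ord B N]. *)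
Definition M (d B N : nat) : Prop :=
  forall x : nat, 1 <= x < N -> coprime x N ->
    block_sum B N d x = 0 %[mod B ^ (ord B N %/ d) - 1].

(* Main.v *)
Require Import Defs.
From mathcomp Require Import all_boot.

(** Modulo [B ^ k - 1] the weight of a digit depends only on its distance to
    the end of the period modulo [k].  Cutting blocks of length [k1] into
    blocks of length [k2] with [k2 %| k1] therefore preserves the block sum
    modulo [B ^ k2 - 1], and [B ^ k2 - 1] divides [B ^ k1 - 1]. *)

Lemma sum_blocks (F : nat -> nat) (d k : nat) :
  \sum_(0 <= j < d) \sum_(0 <= i < k) F (j * k + i) = \sum_(0 <= p < d * k) F p.
Proof.
elim: d => [|d IHd]; first by rewrite !big_geq.
rewrite big_nat_recr //= IHd mulSnr [RHS](@big_cat_nat _ _ _ (d * k)) ?leq_addr //=.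
congr (_ + _); rewrite -[X in _ = \sum_(X <= _ < _) _]add0n big_addn addKn.
by apply: eq_bigr => i _; rewrite addnC.
Qed.

(** Digit [i] of block [j] sits at zero-based position [p = (j - 1) * k + i - 1], so
    [i = (p %% k).+1]. Since [d] divides the order, the [d] blocks fill exactly one period. *)
Lemma block_sumE (B N d x : nat) (k := ord B N %/ d) :
  d %| ord B N ->
  block_sum B N d x =
    \sum_(0 <= p < ord B N) digit B N x p.+1 * B ^ (k - (p %% k).+1).
Proof.
move=> de; rewrite -{1}(divnK de) [_ %/ _ * d]mulnC -sum_blocks /block_sum -/k big_add1 /=.
apply: eq_bigr => j _; rewrite big_add1 /=; apply: eq_big_nat => i /andP[_ ik].
by rewrite subn1 /= addnS modnMDl modn_small.
Qed.

Lemma expn_mod_pred (B k n : nat) :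
  0 < B -> B ^ (k * n) = 1 %[mod B ^ k - 1].
Proof.
move=> B0; rewrite expnM -modnXm.
have {1}-> : B ^ k = B ^ k - 1 + 1 by rewrite subnK // expn_gt0 B0.
by rewrite modnDl modnXm exp1n.
Qed.

Lemma weight_mod (B k m p : nat) : 0 < B -> 0 < k -> 0 < m ->
  B ^ (m * k - (p %% (m * k)).+1) = B ^ (k - (p %% k).+1) %[mod B ^ k - 1].
Proof.
move=> B0 k0 m0; set r := p %% (m * k).
have rmk : r < m * k by rewrite ltn_mod muln_gt0 m0.
have -> : p %% k = r %% k by rewrite modn_dvdm // dvdn_mull.
(* This bound keeps the subtraction [m - (r %/ k).+1] below from truncating; the two exponents then
   differ by a true multiple of [k]. *)
have qm : r %/ k < m by rewrite ltn_divLR.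
have -> : m * k - r.+1 = k * (m - (r %/ k).+1) + (k - (r %% k).+1).
  have rk : r %% k < k by rewrite ltn_mod.
  rewrite mulnC {1}(divn_eq r k) -addnS subnDA [_ %/ k * k]mulnC -mulnBr.
  by rewrite -(subnSK qm) mulnS addnC addnBA // addnC.
by rewrite expnD -modnMml expn_mod_pred // modnMml mul1n.
Qed.

Lemma block_sum_refine (B N d1 d2 x : nat) :
  0 < B -> 0 < ord B N -> d1 %| d2 -> d2 %| ord B N ->
  block_sum B N d1 x = block_sum B N d2 x %[mod B ^ (ord B N %/ d2) - 1].
Proof.
move=> B0 e0 d12 d2e; rewrite !block_sumE ?(dvdn_trans d12) //.
have d20 : 0 < d2 by exact: dvdn_gt0 d2e.
have -> : ord B N %/ d1 = d2 %/ d1 * (ord B N %/ d2).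
  by rewrite mulnC muln_divA // divnK.
have k20 : 0 < ord B N %/ d2 by rewrite divn_gt0 // dvdn_leq.
have m0 : 0 < d2 %/ d1 by rewrite divn_gt0 ?(dvdn_gt0 d20 d12) // dvdn_leq.
(* Both sums now run over the same digits of one period, so only the weights need comparing, term by
   term. *)
apply: (big_rec2 (fun s t => s = t %[mod _])) => // p s t _ st.
rewrite -modnDm st -modnMmr (weight_mod _ _ _ _ B0 k20 m0).
by rewrite modnMmr modnDm.
Qed.

Theorem theorem5 (B N d1 d2 : nat) (hB : 1 < B) (hN : 1 < N)
  (hcop : gcdn N B = 1) (hd1 : 0 < d1) (hd2 : 0 < d2)
  (hd12 : d1 %| d2) (hd2e : d2 %| ord B N) :
  M d1 B N -> M d2 B N.
Proof.
have B0 : 0 < B by exact: ltnW.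
have /ordP[e0 _ _] : coprime B N by rewrite coprime_sym /coprime hcop.
move=> Md1 x xN copx; rewrite -(block_sum_refine _ _ d1) //.
apply/eqP; rewrite mod0n -/(dvdn _ _).
(* The hypothesis on [d1] gives divisibility by the larger modulus; this carries it down to the
   modulus for [d2]. *)
have k21 : B ^ (ord B N %/ d2) - 1 %| B ^ (ord B N %/ d1) - 1.
  rewrite -eqn_mod_dvd ?expn_gt0 ?B0 //; apply/eqP.
  have -> : ord B N %/ d1 = ord B N %/ d2 * (d2 %/ d1).
    by rewrite muln_divA // divnK.
  exact: expn_mod_pred.
by apply: dvdn_trans k21 _; rewrite /dvdn Md1 // mod0n.
Qed.
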